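(* Let $M,a$ be real constants and $k\in\tfrac12\mathbb{Z}$. On the region $\mathcal{U}=\{(t,r,q,\phi): \Delta(r)>0,\ -1<q<1\}$, with $q=\cos\theta$, $\theta\in(0,\pi)$, let $g=\lambda_+^2 g_{Kerr}$ be the complex metric conformal to the Kerr metric, let $\nabla$ be its Levi-Civita connection, $s$ its scalar curvature, and let $a_\mu$ be the complex 1-form defined in the context. Define the operator on smooth complex functions $$\mathcal{O}_k\Phi=-(\nabla^\alpha+{\rm i}k a^\alpha)(\nabla_\alpha+{\rm i}k a_\alpha)\Phi+\frac{1+2k^2}{6}\,s\,\Phi,$$ (indices raised with $g$), and let $\mathcal{O}^T_k$ be the spin-$k$ Teukolsky operator $$\mathcal{O}_k^T = \Big[\tfrac{(r^2 + a^2)^2}{\Delta} - a^2 \sin^2\theta\Big]\partial_t^2 + \tfrac{4Mar}{\Delta}\partial_t \partial_\phi + \Big[\tfrac{a^2}{\Delta} - \tfrac{1}{\sin^2\theta}\Big]\partial_\phi^2 - \Delta^{-k}\partial_r ( \Delta^{k+1}\partial_r ) - \tfrac{1}{\sin\theta}\partial_\theta ( \sin\theta\, \partial_\theta ) - 2k \Big[ \tfrac{M(r^2 - a^2)}{\Delta}- r + {\rm i} a \cos\theta \Big]\partial_t - 2k \Big[\tfrac{a(r-M)}{\Delta} - \tfrac{{\rm i}\cos\theta}{\sin^2\theta} \Big]\partial_\phi + \left(k^2 \cot^2\theta - k\right).$$ Then, as operators on smooth complex functions on $\mathcal{U}$, $$\mathcal{O}^T_k = \frac{\lambda_+}{\lambda_-}\,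 \frac{\lambda_+}{\Delta^{k/2}}\, \mathcal{O}_k \circ \frac{\Delta^{k/2}}{\lambda_+},$$ i.e. $\mathcal{O}^T_k\Phi=\frac{\lambda_+}{\lambda_-}\frac{\lambda_+}{\Delta^{k/2}}\,\mathcal{O}_k\!\left(\frac{\Delta^{k/2}}{\lambda_+}\Phi\right)$ for all $\Phi$.
   Context: Coordinates $(t,r,q,\phi)$, $q=\cos\theta$. Set $C(r)=\Delta(r)=r^2-2Mr+a^2$, $D(q)=1-q^2=\sin^2\theta$, $\rho^2=r^2+a^2q^2$, $A=dt-a(1-q^2)\,d\phi$, $B=a\,dt-(r^2+a^2)\,d\phi$. The Kerr metric is $g_{Kerr}=-\frac{C}{\rho^2}A^2+\frac{\rho^2}{C}dr^2+\frac{\rho^2}{D}dq^2+\frac{D}{\rho^2}B^2$. Define $\lambda_\pm=\frac{1}{r\pm{\rm i}aq}$ (so $\rho^2=(\lambda_+\lambda_-)^{-1}$) and the complex-valued metric $g=\lambda_+^2 g_{Kerr}$; its Levi-Civita connection and scalar curvature are computed by the usual formulas (complex-valued). The 1-form $a$ is $$a={\rm i}\,\frac{C}{\rho^2}\Big(\frac{C_r}{2C}-2\lambda_+\Big)A-\frac{D}{\rho^2}\Big(\frac{D_q}{2D}-2{\rm i}a\lambda_+\Big)B,$$ where $C_r=\partial_rC$, $D_q=\partial_qD$ (equivalently, $a=J\,d\log(\sqrt{CD}\,\lambda_+^2)$ with $J$ the endomorphism obtained from the 2-form ${\rm i}A\wedge dr-B\wedge dq$ by raising an index with $g_{Kerr}$).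 In $(\nabla_\alpha+{\rm i}ka_\alpha)$ applied to a function $\Phi$ one gets the 1-form $\partial_\alpha\Phi+{\rm i}ka_\alpha\Phi$, and $(\nabla^\alpha+{\rm i}ka^\alpha)$ applied to a 1-form $v_\alpha$ gives $\nabla^\alpha v_\alpha+{\rm i}ka^\alpha v_\alpha$.
   Formalization: The ring r=0, q=0 is removed from the region U: when a≠0 it satisfies Δ(r)=a²>0 and -1<q<1, but there ρ²=0 and λ₊ and the metric g are undefined. *)

(* Defs.v *)
(* R : realType, complex numbers R[i]
   (mathcomp-real-closed `complex`).  Points of R^4 are row vectors 'rV[R]_4
   with coordinates (x^0,x^1,x^2,x^3) = (t,r,q,phi)  (or (t,r,theta,phi) for
   the Teukolsky operator). *)
From mathcomp Require Import all_boot all_order all_algebra.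
From mathcomp Require Import all_classical all_reals all_analysis.
From mathcomp Require Import complex.
Import Order.TTheory GRing.Theory Num.Theory ComplexField.
Import numFieldNormedType.Exports.

Set Implicit Arguments.
Unset Strict Implicit.
Unset Printing Implicit Defensive.

Local Open Scope ring_scope.
Local Open Scope complex_scope.

Section KerrTeukolsky.
Context {R : realType}.

Local Notation pt := ('rV[R]_4).
Local Notation C := (R[i]).

Definition i0 : 'I_4 := @Ordinal 4 0 isT.
Definition i1 : 'I_4 := @Ordinal 4 1 isT.
Definition i2 : 'I_4 := @Ordinal 4 2 isT.
Definition i3 : 'I_4 := @Ordinal 4 3 isT.

Definition kcoord (x : pt) (i : 'I_4) : R := x ord0 i.

Definition mkpt (x0 x1 x2 x3 : R) : pt :=
  \row_(i < 4) nth 0 [:: x0; x1; x2; x3] i.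

Definition ei (i : 'I_4) : pt := delta_mx ord0 i.

Definition pd (i : 'I_4) (f : pt -> C) (x : pt) : C :=
  Complex (derive1 (fun s : R => complex.Re (f (x + s *: ei i))) 0)
          (derive1 (fun s : R => complex.Im (f (x + s *: ei i))) 0).

Definition iterpd (l : seq 'I_4) (f : pt -> C) : pt -> C :=
  foldr (fun i g => pd i g) f l.

Definition smooth_on (U : set pt) (f : pt -> C) : Prop :=
  forall (l : seq 'I_4) (x : pt), U x ->
    (forall i : 'I_4,
        derivable (fun s : R => complex.Re (iterpd l f (x + s *: ei i))) 0 1 /\
        derivable (fun s : R => complex.Im (iterpd l f (x + s *: ei i))) 0 1) /\
    {for x, continuous (fun y => complex.Re (iterpd l f y))} /\
    {for x, continuous (fun y => complex.Im (iterpd l f y))}.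

Definition Delta (M a r : R) : R := r ^+ 2 - 2 * M * r + a ^+ 2.
Definition Dq (q : R) : R := 1 - q ^+ 2.
Definition rho2 (a r q : R) : R := r ^+ 2 + a ^+ 2 * q ^+ 2.

(* region U = {Delta(r) > 0, -1 < q < 1}, with the ring singularity
   rho^2 = 0 (where lambda_+ and the metric are undefined) removed *)
Definition regionU (M a : R) : set pt :=
  [set x | 0 < Delta M a (kcoord x i1) /\ -1 < kcoord x i2 < 1 /\
           rho2 a (kcoord x i1) (kcoord x i2) != 0].

Definition formA (a : R) (x : pt) (mu : 'I_4) : R :=
  if mu == i0 then 1 else if mu == i3 then - a * Dq (kcoord x i2) else 0.
Definition formB (a : R) (x : pt) (mu : 'I_4) : R :=
  if mu == i0 then a else if mu == i3 then - (kcoord x i1 ^+ 2 + a ^+ 2) else 0.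

Definition kd (i mu nu : 'I_4) : R := ((mu == i) && (nu == i))%:R.

Definition gKerr (M a : R) (x : pt) (mu nu : 'I_4) : R :=
  let r := kcoord x i1 in let q := kcoord x i2 in
  - (Delta M a r / rho2 a r q) * formA a x mu * formA a x nu
  + (rho2 a r q / Delta M a r) * kd i1 mu nu
  + (rho2 a r q / Dq q) * kd i2 mu nu
  + (Dq q / rho2 a r q) * formB a x mu * formB a x nu.

Definition lamp (a : R) (x : pt) : C :=
  (Complex (kcoord x i1) (a * kcoord x i2))^-1.
Definition lamm (a : R) (x : pt) : C :=
  (Complex (kcoord x i1) (- (a * kcoord x i2)))^-1.

Definition gmet (M a : R) (x : pt) : 'M[C]_4 :=
  \matrix_(mu, nu) (lamp a x ^+ 2 * (gKerr M a x mu nu)%:C).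
Definition ginv (M a : R) (x : pt) : 'M[C]_4 := invmx (gmet M a x).

Definition Chr (M a : R) (x : pt) (c al be : 'I_4) : C :=
  2^-1 * \sum_(d < 4) ginv M a x c d *
    (pd al (fun y => gmet M a y d be) x + pd be (fun y => gmet M a y d al) x
     - pd d (fun y => gmet M a y al be) x).

Definition Ric (M a : R) (x : pt) (be de : 'I_4) : C :=
  \sum_(c < 4) (pd c (fun y => Chr M a y c be de) x
                - pd de (fun y => Chr M a y c be c) x
                + \sum_(e < 4) (Chr M a x c c e * Chr M a x e be de
                                - Chr M a x c de e * Chr M a x e be c)).

Definition scal (M a : R) (x : pt) : C :=
  \sum_(be < 4) \sum_(de < 4) ginv M a x be de * Ric M a x be de.

(* the 1-form a_mu:
   a = i (C/rho^2)(C_r/(2C) - 2 lambda_+) A - (D/rho^2)(D_q/(2D) - 2 i a lambda_+) B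
   with C_r = 2r - 2M, D_q = -2q *)
Definition aform (M a : R) (x : pt) (mu : 'I_4) : C :=
  let r := kcoord x i1 in let q := kcoord x i2 in
  'i * (Delta M a r / rho2 a r q)%:C
     * (((2 * r - 2 * M) / (2 * Delta M a r))%:C - 2%:R * lamp a x)
     * (formA a x mu)%:C
  - (Dq q / rho2 a r q)%:C
     * (((- (2 * q)) / (2 * Dq q))%:C - 2%:R * 'i * a%:C * lamp a x)
     * (formB a x mu)%:C.

Definition vfield (M a k : R) (Phi : pt -> C) (x : pt) (al : 'I_4) : C :=
  pd al Phi x + 'i * k%:C * aform M a x al * Phi x.

Definition Ok (M a k : R) (Phi : pt -> C) (x : pt) : C :=
  - (\sum_(al < 4) \sum_(be < 4) ginv M a x al be *
       (pd be (fun y => vfield M a k Phi y al) x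
        - \sum_(c < 4) Chr M a x c be al * vfield M a k Phi x c
        + 'i * k%:C * aform M a x be * vfield M a k Phi x al))
  + ((1 + 2 * k ^+ 2) / 6)%:C * scal M a x * Phi x.

(* spin-k Teukolsky operator in Boyer-Lindquist coordinates (t,r,theta,phi),
   acting on Psi : pt -> C where pt coordinates are (t,r,theta,phi) *)
Definition Teuk (M a k : R) (Psi : pt -> C) (y : pt) : C :=
  let r := kcoord y i1 in let th := kcoord y i2 in
  let D := Delta M a r in
  (((r ^+ 2 + a ^+ 2) ^+ 2 / D - a ^+ 2 * sin th ^+ 2)%:C) * pd i0 (pd i0 Psi) y
  + ((4 * M * a * r / D)%:C) * pd i0 (pd i3 Psi) y
  + ((a ^+ 2 / D - 1 / sin th ^+ 2)%:C) * pd i3 (pd i3 Psi) y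
  - ((D `^ (- k))%:C) *
      pd i1 (fun z => ((Delta M a (kcoord z i1)) `^ (k + 1))%:C * pd i1 Psi z) y
  - ((1 / sin th)%:C) * pd i2 (fun z => (sin (kcoord z i2))%:C * pd i2 Psi z) y
  - (2 * k)%:C * ((M * (r ^+ 2 - a ^+ 2) / D - r)%:C + 'i * (a * cos th)%:C)
      * pd i0 Psi y
  - (2 * k)%:C * ((a * (r - M) / D)%:C - 'i * (cos th / sin th ^+ 2)%:C)
      * pd i3 Psi y
  + ((k ^+ 2 * (cos th / sin th) ^+ 2 - k)%:C) * Psi y.

End KerrTeukolsky.

(* Main.v *)
Require Import Defs.
From mathcomp Require Import all_boot all_order all_algebra.
From mathcomp Require Import all_classical all_reals all_analysis.
From mathcomp Require Import complex ring.
Import Order.TTheory GRing.Theory Num.Theory ComplexField.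
Import numFieldNormedType.Exports.
Local Open Scope ring_scope.
Local Open Scope complex_scope.

(* Put z = r + i a q and w = r - i a q, so that lambda_+ = 1/z, lambda_- = 1/w
   and rho^2 = z w.  All components of the metric g are rational functions of r
   and q whose denominators are products of z, w, C = Delta and D = 1 - q^2, and
   the inverse metric is
     (z/w) (- X X / C + C d_r d_r + D d_q d_q + Y Y / D)
   with X = (r^2 + a^2) d_t + a d_phi and Y = a (1 - q^2) d_t + d_phi.  Hence
   both sides of the theorem are computed by formal differentiation of rational
   expressions, and the statement becomes an identity in a field.  The scalar
   curvature is s = 12 M lambda_+.  The only other input is the symmetry of the
   mixed derivative of Phi in t and phi. *)

Set Implicit Arguments.
Unset Strict Implicit.
Unset Printing Implicit Defensive.

(** * Formal expressions and their derivatives *)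

(* [XC1], [XD1] stand for the derivatives of C = Delta(r) and D = 1 - q^2;
   [Xzi], [Xwi], [XCi], [XDi] for the inverses of z = r + i a q, w = r - i a q,
   C and D; [XW] for Delta^(k/2); [Kb] for i a; [XPhi l] for the iterated
   partial derivative of the unknown function along [l]. *)
Inductive atom :=
  | Xr | Xq | XC | XC1 | XD | XD1 | Xzi | Xwi | XCi | XDi | XW
  | Ka | Kb | Ki | Kk | Khalf
  | XPhi of seq 'I_4.

Inductive expr :=
  | E0 | E1 | EA of atom | EN of expr | ED of expr & expr | EM of expr & expr.

Declare Scope expr_scope.
Delimit Scope expr_scope with X.
Bind Scope expr_scope with expr.
Coercion EA : atom >-> expr.

(* The operations drop zeros and ones on the fly: most components of the
   metric vanish, and this keeps the curvature expression small. *)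
Definition addX (e f : expr) : expr :=
  match e, f with E0, _ => f | _, E0 => e | _, _ => ED e f end.
Definition mulX (e f : expr) : expr :=
  match e, f with
  | E0, _ | _, E0 => E0
  | E1, _ => f
  | _, E1 => e
  | _, _ => EM e f
  end.
Definition oppX (e : expr) : expr := if e is E0 then E0 else EN e.

Notation "x + y" := (addX x y) : expr_scope.
Notation "x * y" := (mulX x y) : expr_scope.
Notation "- x" := (oppX x) : expr_scope.
Notation "x - y" := (addX x (oppX y)) : expr_scope.
Notation "0" := E0 : expr_scope.
Notation "1" := E1 : expr_scope.
Notation "2" := (ED E1 E1) : expr_scope.

Variant coord := It | Ir | Iq | Ip.

Definition coord_of (i : 'I_4) : coord :=
  match nat_of_ord i with 0 => It | 1 => Ir | 2 => Iq | _ => Ip end%N.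

(** Derivatives of atoms are again expressions in atoms: [C'' = 2] and [D'' = -2] are constants, and
    the inverses and [XW] are differentiated in terms of themselves. [XPhi] lists the outermost
    derivative first, as [iterpd] does. *)
Definition derA (i : 'I_4) (x : atom) : expr :=
  match x with
  | XPhi l => XPhi (i :: l)
  | _ => match coord_of i, x with
    | Ir, Xr => 1
    | Ir, XC => XC1
    | Ir, XC1 => 2
    | Ir, Xzi => - (Xzi * Xzi)
    | Ir, Xwi => - (Xwi * Xwi)
    | Ir, XCi => - (XC1 * (XCi * XCi))
    | Ir, XW => Khalf * (Kk * (XC1 * (XCi * XW)))
    | Iq, Xq => 1
    | Iq, XD => XD1
    | Iq, XD1 => - (2)
    | Iq, Xzi => - (Kb * (Xzi * Xzi))
    | Iq, Xwi => Kb * (Xwi * Xwi)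
    | Iq, XDi => - (XD1 * (XDi * XDi))
    | _, _ => 0
    end
  end%X.

Fixpoint der (i : 'I_4) (e : expr) : expr :=
  match e with
  | E0 | E1 => 0
  | EA x => derA i x
  | EN f => - der i f
  | ED f g => der i f + der i g
  | EM f g => der i f * g + f * der i g
  end%X.

(** The sum is spelled out with [addX], so that vanishing components disappear when the expression
    is computed. *)
Definition sumX (f : 'I_4 -> expr) : expr := (f i0 + f i1 + f i2 + f i3)%X.

Lemma ord4_ind (P : 'I_4 -> Prop) :
  P i0 -> P i1 -> P i2 -> P i3 -> forall i, P i.
Proof.
move=> p0 p1 p2 p3 [[|[|[|[|//]]]] h].
- by rewrite (_ : Ordinal h = i0)//; apply: val_inj.
- by rewrite (_ : Ordinal h = i1)//; apply: val_inj.
- by rewrite (_ : Ordinal h = i2)//; apply: val_inj.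
- by rewrite (_ : Ordinal h = i3)//; apply: val_inj.
Qed.

Lemma sum_ord4 (V : nmodType) (G : 'I_4 -> V) :
  \sum_(i < 4) G i = G i0 + G i1 + G i2 + G i3.
Proof.
rewrite !big_ord_recl big_ord0 addr0 !addrA.
by congr (G _ + G _ + G _ + G _); apply: val_inj.
Qed.

Section Evaluation.
Variables (F : nzRingType) (v : atom -> F).

Fixpoint ev (e : expr) : F :=
  match e with
  | E0 => 0
  | E1 => 1
  | EA x => v x
  | EN f => - ev f
  | ED f g => ev f + ev g
  | EM f g => ev f * ev g
  end.

Lemma ev_add e f : ev (e + f)%X = ev e + ev f.
Proof. by case: e => //=; case: f => //= *; rewrite ?addr0 ?add0r. Qed.

Lemma ev_mul e f : ev (e * f)%X = ev e * ev f.
Proof.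
by case: e => //=; case: f => //= *; rewrite ?mulr0 ?mul0r ?mulr1 ?mul1r.
Qed.

Lemma ev_opp e : ev (- e)%X = - ev e.
Proof. by case: e => //=; rewrite oppr0. Qed.

Definition evE := (ev_add, ev_mul, ev_opp).

Lemma ev_sum f : ev (sumX f) = \sum_(i < 4) ev (f i).
Proof. by rewrite sum_ord4 !ev_add. Qed.

End Evaluation.

(** * The metric, its curvature and the wave operator as expressions *)

Definition zX : expr := (Xr + Kb * Xq)%X.
Definition wX : expr := (Xr - Kb * Xq)%X.

(** The factor [1 - q^2] of the coframe is written out instead of using [XD]. This keeps [XC] and
    [XD] free of the coordinates, as the generality of [ev_scal] demands. *)
Definition AX (i : 'I_4) : expr :=
  match coord_of i with It => 1 | Ip => - (Ka * (1 - Xq * Xq)) | _ => 0 end%X.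
Definition BX (i : 'I_4) : expr :=
  match coord_of i with It => Ka | Ip => - (Xr * Xr + Ka * Ka) | _ => 0 end%X.

(** Since [rho^2 = z w], the coefficients are [lambda_+^2 rho^2 = w / z] and
    [lambda_+^2 / rho^2 = 1 / (z^3 w)]. *)
Definition gX (m n : 'I_4) : expr :=
  match coord_of m, coord_of n with
  | Ir, Ir => wX * Xzi * XCi
  | Iq, Iq => wX * Xzi * XDi
  | Ir, _ | Iq, _ | _, Ir | _, Iq => 0
  | _, _ => Xzi * Xzi * Xzi * Xwi * (XD * (BX m * BX n) - XC * (AX m * AX n))
  end%X.

(* [eAX], [eBX] is the frame of the (t, phi)-plane dual to the coframe A, B. *)
Definition eAX (i : 'I_4) : expr :=
  match coord_of i with
  | It => Xzi * Xwi * (Xr * Xr + Ka * Ka)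
  | Ip => Xzi * Xwi * Ka
  | _ => 0
  end%X.
Definition eBX (i : 'I_4) : expr :=
  match coord_of i with
  | It => - (Xzi * Xwi * (Ka * (1 - Xq * Xq)))
  | Ip => - (Xzi * Xwi)
  | _ => 0
  end%X.

Definition giX (m n : 'I_4) : expr :=
  match coord_of m, coord_of n with
  | Ir, Ir => zX * Xwi * XC
  | Iq, Iq => zX * Xwi * XD
  | Ir, _ | Iq, _ | _, Ir | _, Iq => 0
  | _, _ =>
    zX * zX * zX * wX * (XDi * (eBX m * eBX n) - XCi * (eAX m * eAX n))
  end%X.

Definition chrX (c m n : 'I_4) : expr :=
  (Khalf * sumX (fun d =>
     giX c d * (der m (gX d n) + der n (gX d m) - der d (gX m n))))%X.

Definition ricX (b d : 'I_4) : expr :=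
  sumX (fun c => der c (chrX c b d) - der d (chrX c b c)
    + sumX (fun e => chrX c c e * chrX e b d - chrX c d e * chrX e b c))%X.

Definition scalX : expr :=
  sumX (fun b => sumX (fun d => giX b d * ricX b d))%X.

Definition aX (m : 'I_4) : expr :=
  (Ki * XC * Xzi * Xwi * (Khalf * XC1 * XCi - 2 * Xzi) * AX m
   - XD * Xzi * Xwi * (Khalf * XD1 * XDi - 2 * Kb * Xzi) * BX m)%X.

Definition PX : expr := (XW * zX * XPhi [::])%X.

Definition vX (m : 'I_4) : expr := (der m PX + Ki * Kk * aX m * PX)%X.

Definition boxX : expr :=
  sumX (fun m => sumX (fun n => giX m n *
    (der n (vX m) - sumX (fun c => chrX c n m * vX c)
     + Ki * Kk * aX n * vX m)))%X.

(** * Field identities for the inverse metric, the scalar curvature and the wave operator *)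

Definition kerr_valuation (F : numFieldType) (v : atom -> F) :=
  [/\ [/\ v Kb = v Ki * v Ka, v Ki ^+ 2 = -1 & v Khalf = 2^-1],
      [/\ v Xzi = (v Xr + v Kb * v Xq)^-1, v Xwi = (v Xr - v Kb * v Xq)^-1,
          v XCi = (v XC)^-1 & v XDi = (v XD)^-1] &
      [/\ v Xr + v Kb * v Xq != 0, v Xr - v Kb * v Xq != 0, v XC != 0
        & v XD != 0]].

(** The (r, q) block is diagonal, and on the (t, phi) block the frame [eAX], [eBX] is dual to [AX],
    [BX] because [r^2 + a^2 q^2 = z w]. *)
Lemma ev_gX_giX (F : numFieldType) (v : atom -> F) m n : kerr_valuation v ->
  \sum_(c < 4) ev v (gX m c) * ev v (giX c n) = (m == n)%:R.
Proof.
case=> -[eb eI eh] [ez ew eC eD] [nz nw nC nD].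
have ea : v Ka ^+ 2 = - v Kb ^+ 2 by rewrite eb exprMn eI mulN1r opprK.
rewrite sum_ord4; elim/ord4_ind: m; elim/ord4_ind: n => /=.
all: rewrite ?ez ?ew ?eC ?eD; move: ea nz nw nC nD; clear.
all: move: (v Xr) (v Xq) (v XC) (v XD) (v Ka) (v Kb).
all: move=> r q C D a b ea nz nw nC nD.
all: by field: ea; rewrite ?nz ?nw ?nC ?nD.
Qed.

(* The identity is linear in C and D and only uses C'' + D'' = 0: neither the
   mass nor the relation between C and D and the coordinates enters. *)
Lemma ev_scal (F : numFieldType) (v : atom -> F) : kerr_valuation v ->
  ev v scalX = 6 * v Xwi * (v XC1 + v Kb * v XD1)
               - 12 * v Xzi * v Xwi * (v XC + v Kb ^+ 2 * v XD).
Proof.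
case=> -[eb eI eh] [ez ew eC eD] [nz nw nC nD].
set s := RHS.
(* Only the closed formal expression is computed, zeros being dropped on the way; [ev] is unfolded
   afterwards, leaving the operations of [F] untouched. *)
let e := eval vm_compute in scalX in change (ev v e = s).
rewrite {}/s; cbn [ev]; rewrite ez ew eC eD eh.
(* The imaginary unit enters the curvature only through [b = i a], so [a^2 = - b^2] is the one
   relation that [field] has to know. *)
have ea : v Ka ^+ 2 = - v Kb ^+ 2 by rewrite eb exprMn eI mulN1r opprK.
move: nz nw nC nD ea; clear.
move: (v Xr) (v Xq) (v XC) (v XC1) (v XD) (v XD1) (v Ka) (v Kb).
move=> r q C C1 D D1 a b nz nw nC nD ea.
by field: ea; rewrite nz nw nC nD.
Qed.

(** This is [Teuk] in the variable [q = cos theta], with [sin^2 theta = D] and both outer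
    derivatives expanded; the powers of [Delta] have cancelled and the coefficients are rational. *)
Definition teukolsky_form (F : numFieldType) (M : F) (v : atom -> F) : F :=
  ((v Xr ^+ 2 + v Ka ^+ 2) ^+ 2 / v XC - v Ka ^+ 2 * v XD)
    * v (XPhi [:: i0; i0])
  + 4 * M * v Ka * v Xr / v XC * v (XPhi [:: i0; i3])
  + (v Ka ^+ 2 / v XC - 1 / v XD) * v (XPhi [:: i3; i3])
  - (v XC * v (XPhi [:: i1; i1]) + (v Kk + 1) * v XC1 * v (XPhi [:: i1]))
  - (v XD * v (XPhi [:: i2; i2]) + v XD1 * v (XPhi [:: i2]))
  - 2 * v Kk
    * (M * (v Xr ^+ 2 - v Ka ^+ 2) / v XC - v Xr + v Ki * (v Ka * v Xq))
    * v (XPhi [:: i0])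
  - 2 * v Kk * (v Ka * (v Xr - M) / v XC - v Ki * (v Xq / v XD))
    * v (XPhi [:: i3])
  + (v Kk ^+ 2 * (v Xq ^+ 2 / v XD) - v Kk) * v (XPhi [::]).

(** The scalar curvature enters as a value [s], so its long expression is not expanded again. [XW]
    differentiates to a multiple of itself and cancels against the prefactor; what remains is a
    rational identity modulo [i^2 = -1]. *)
Lemma ev_box (F : numFieldType) (v : atom -> F) (M s : F) :
  kerr_valuation v -> v XW != 0 ->
  v XC = v Xr ^+ 2 - 2 * M * v Xr + v Ka ^+ 2 -> v XD = 1 - v Xq ^+ 2 ->
  v XC1 = 2 * v Xr - 2 * M -> v XD1 = - (2 * v Xq) ->
  v (XPhi [:: i0; i3]) = v (XPhi [:: i3; i0]) -> s = 12 * M * v Xzi ->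
  v Xzi / v Xwi * (v Xzi / v XW)
    * (- ev v boxX + (1 + 2 * v Kk ^+ 2) / 6 * s * ev v PX) =
  teukolsky_form M v.
Proof.
case=> -[eb eI eh] [ez ew eC eD] [nz nw nC nD] nW cC cD cC1 cD1 eP ->.
rewrite /teukolsky_form.
let e := eval vm_compute in boxX in change boxX with e.
cbn [ev PX mulX addX oppX zX]; rewrite ez ew eC eD eh.
(* The computed expression contains the indices in unfolded form; after unfolding them everywhere,
   [eP] merges the two mixed derivatives into one unknown. *)
rewrite /i0 /i1 /i2 /i3 in eP *; rewrite eP.
move: nz nw nC nD eI; rewrite cC cD cC1 cD1 eb; move: nW; clear.
move: (v Xr) (v Xq) (v Ka) (v Ki) (v Kk) (v XW) => r q a I k W.
(* The ten unknowns are [Phi], its four first derivatives, and the second derivatives tt, rr, qq,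
   phi phi and t phi. *)
do 10 move: (v (XPhi _)) => ?.
move=> nW nz nw nC nD eI.
by field: eI; rewrite nz nw nC nD nW.
Qed.

(** * Partial derivatives of complex-valued functions *)

Section PartialDerivative.
Context {R : realType}.
Local Notation pt := ('rV[R]_4).
Local Notation C := (R[i]).
Implicit Types (i j : 'I_4) (f g : pt -> C) (x y : pt) (s u : R) (l : C).

(** [pd] has a value even where a function is not derivable. [is_pd] also records derivability of
    both parts, so that the differentiation rules can be chained. *)
Definition is_pd i f x l :=
  is_derive (0 : R) 1 (fun s => complex.Re (f (x + s *: ei i))) (complex.Re l)
  /\ is_derive (0 : R) 1 (fun s => complex.Im (f (x + s *: ei i)))
       (complex.Im l).

Lemma is_pd_val i f x l : is_pd i f x l -> pd i f x = l.
Proof.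
case: l => a b [/= dr di]; rewrite /pd !derive1E.
by congr Complex; apply: derive_val.
Qed.

Lemma is_pd_eq i f x l l' : is_pd i f x l -> l = l' -> is_pd i f x l'.
Proof. by move=> + <-. Qed.

Lemma near_eq_is_pd i f g x l :
  (\forall s \near (0 : R), f (x + s *: ei i) = g (x + s *: ei i)) ->
  is_pd i f x l -> is_pd i g x l.
Proof.
move=> fg [dr di]; split.
- by apply: near_eq_is_derive dr; near do congr complex.Re.
- by apply: near_eq_is_derive di; near do congr complex.Im.
Unshelve. all: by end_near. Qed.

Lemma is_pd_cst i (c : C) x : is_pd i (fun=> c) x 0.
Proof. by split; exact: is_derive_cst. Qed.

Lemma is_pdN i f x l : is_pd i f x l -> is_pd i (fun y => - f y) x (- l).
Proof.
case: l => a b [dr di]; split => /=.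
- rewrite (_ : (fun s => _) = - (fun s => complex.Re (f (x + s *: ei i)))).
    exact: is_deriveN.
  by apply/funext => s /=; rewrite -[RHS]/(- _); case: (f _).
- rewrite (_ : (fun s => _) = - (fun s => complex.Im (f (x + s *: ei i)))).
    exact: is_deriveN.
  by apply/funext => s /=; rewrite -[RHS]/(- _); case: (f _).
Qed.

Lemma is_pdD i f g x l l' :
  is_pd i f x l -> is_pd i g x l' -> is_pd i (fun y => f y + g y) x (l + l').
Proof.
case: l l' => [a b] [a' b'] [dr di] [dr' di']; split => /=.
- rewrite (_ : (fun s => _) = (fun s => complex.Re (f (x + s *: ei i)))
                              + (fun s => complex.Re (g (x + s *: ei i)))).
    exact: is_deriveD.
  by apply/funext => s /=; rewrite -[RHS]/(_ + _); case: (f _) (g _) => ? ? [].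
- rewrite (_ : (fun s => _) = (fun s => complex.Im (f (x + s *: ei i)))
                              + (fun s => complex.Im (g (x + s *: ei i)))).
    exact: is_deriveD.
  by apply/funext => s /=; rewrite -[RHS]/(_ + _); case: (f _) (g _) => ? ? [].
Qed.

Lemma is_pdM i f g x l l' : is_pd i f x l -> is_pd i g x l' ->
  is_pd i (fun y => f y * g y) x (l * g x + f x * l').
Proof.
case: l l' => [a b] [a' b'] [dr di] [dr' di'].
have x0 : x + (0 : R) *: ei i = x by rewrite scale0r addr0.
split.
- have := is_deriveB (is_deriveM dr dr') (is_deriveM di di').
  rewrite x0 => h; apply: is_derive_eq.
    rewrite (_ : (fun s => _) =
      (fun s => complex.Re (f (x + s *: ei i)))
      * (fun s => complex.Re (g (x + s *: ei i)))
      - (fun s => complex.Im (f (x + s *: ei i)))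
        * (fun s => complex.Im (g (x + s *: ei i)))).
      exact: h.
    apply/funext => s /=; rewrite -[RHS]/(_ * _ - _ * _).
    by case: (f _) (g _) => ? ? [].
  by case: (f x) (g x) => c d [c' d'] /=; rewrite /GRing.scale /=; ring.
- have := is_deriveD (is_deriveM dr di') (is_deriveM di dr').
  rewrite x0 => h; apply: is_derive_eq.
    rewrite (_ : (fun s => _) =
      (fun s => complex.Re (f (x + s *: ei i)))
      * (fun s => complex.Im (g (x + s *: ei i)))
      + (fun s => complex.Im (f (x + s *: ei i)))
        * (fun s => complex.Re (g (x + s *: ei i)))).
      exact: h.
    apply/funext => s /=; rewrite -[RHS]/(_ * _ + _ * _).
    by case: (f _) (g _) => ? ? [].
  by case: (f x) (g x) => c d [c' d'] /=; rewrite /GRing.scale /=; ring.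
Qed.

Lemma kcoordD x s i j : kcoord (x + s *: ei i) j = kcoord x j + s * (i == j)%:R.
Proof. by rewrite /kcoord /ei !mxE eqxx eq_sym. Qed.

Lemma is_pd_coord (h : R -> R) (d : R) i j x :
  is_derive (kcoord x j) 1 h d ->
  is_pd i (fun y => (h (kcoord y j))%:C) x (if i == j then d%:C else 0).
Proof.
case: eqP => [<-|/eqP/negbTE ij] dh; split => /=; try exact: is_derive_cst.
- rewrite -[X in is_derive _ _ _ X]mulr1.
  rewrite (_ : (fun s => _) = h \o (fun s => kcoord x i + s)); last first.
    by apply/funext => s /=; rewrite kcoordD eqxx mulr1.
  apply: is_derive1_comp; first by rewrite addr0.
  rewrite -[X in is_derive _ _ _ X]add0r.
  exact: is_deriveD.
- rewrite (_ : (fun s => _) = cst (h (kcoord x j))); first exact: is_derive_cst.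
  by apply/funext => s /=; rewrite kcoordD ij mulr0 addr0.
Qed.

(** Writing [1 / f] as the conjugate of [f] times [N = 1 / |f|^2] reduces the claim to the real
    product and inverse rules for each part. *)
Lemma is_pdV i f x l : f x != 0 -> is_pd i f x l ->
  is_pd i (fun y => (f y)^-1) x (- (l * ((f x)^-1 * (f x)^-1))).
Proof.
case: l => a b fx0 [/= dr di].
have x0 : x + (0 : R) *: ei i = x by rewrite scale0r addr0.
pose fr := fun s => complex.Re (f (x + s *: ei i)).
pose fi := fun s => complex.Im (f (x + s *: ei i)).
have {}dr : is_derive (0 : R) 1 fr a := dr.
have {}di : is_derive (0 : R) 1 fi b := di.
have fr0 : fr 0 = complex.Re (f x) by rewrite /fr x0.
have fi0 : fi 0 = complex.Im (f x) by rewrite /fi x0.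
have n0 : fr 0 ^+ 2 + fi 0 ^+ 2 != 0.
  rewrite fr0 fi0; apply: contra fx0; rewrite paddr_eq0 ?sqr_ge0 // !sqrf_eq0.
  by case: (f x) => ? ? /=; rewrite eq_complex.
pose N := fun s => (fr s ^+ 2 + fi s ^+ 2)^-1.
have dN : is_derive (0 : R) 1 N (- (fr 0 ^+ 2 + fi 0 ^+ 2) ^- 2
                                 * (2 * fr 0 * a + 2 * fi 0 * b)).
  exact: is_deriveV (is_deriveD (is_deriveX 2 dr) (is_deriveX 2 di)).
split.
- apply: is_derive_eq.
    rewrite (_ : (fun s => _) = fr * N); first exact: is_deriveM dr dN.
    apply/funext => s; rewrite -[RHS]/(fr s * N s) /N /fr /fi.
    by case: (f _).
  rewrite /GRing.scale /= /N; move: n0; rewrite fr0 fi0.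
  by case: (f x) => c d /= n0; field; rewrite n0.
- apply: is_derive_eq.
    rewrite (_ : (fun s => _) = (- fi) * N).
      exact: is_deriveM (is_deriveN di) dN.
    apply/funext => s; rewrite -[RHS]/(- fi s * N s) /N /fr /fi.
    by case: (f _) => ? ? /=; rewrite mulNr.
  rewrite /GRing.scale /= -[(- fi) 0]/(- fi 0) /N; move: n0; rewrite fr0 fi0.
  by case: (f x) => c d /= n0; field; rewrite n0.
Qed.

End PartialDerivative.

(** * Functions of (r, q) on the Kerr exterior *)

Section Valuation.
Context {R : realType}.
Local Notation pt := ('rV[R]_4).
Local Notation C := (R[i]).
Variables (M a k : R).
Local Notation U := (regionU M a).
Implicit Types (i j : 'I_4) (x y : pt) (r q : R) (l : seq 'I_4) (e : expr).

Lemma rho2_ge0 r q : 0 <= rho2 a r q.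
Proof. by rewrite /rho2 -exprMn addr_ge0 ?sqr_ge0. Qed.

(** [U] is cut out by strict inequalities between continuous functions, once [rho2 != 0] is read as
    [0 < rho2]. The general path [f] covers coordinate lines as well as their images under
    [q = cos theta]. *)
Lemma cvg_region (T : Type) (F : set_system T) {FF : Filter F} (f : T -> pt) x :
  U x -> (forall j, kcoord (f s) j @[s --> F] --> kcoord x j)%classic ->
  \forall s \near F, U (f s).
Proof.
move=> -[/= D0 [/andP[q1 q2] n0]] cf.
have cD : (Delta M a (kcoord (f s) i1) @[s --> F]
           --> Delta M a (kcoord x i1))%classic.
  rewrite /Delta; apply: cvgD; last exact: cvg_cst.
  apply: cvgB.
    by rewrite expr2; under eq_fun do rewrite expr2; exact: cvgM.
  by apply: cvgM => //; exact: cvg_cst.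
have cn : (rho2 a (kcoord (f s) i1) (kcoord (f s) i2) @[s --> F]
           --> rho2 a (kcoord x i1) (kcoord x i2))%classic.
  rewrite /rho2; under eq_fun do rewrite !expr2; rewrite !expr2.
  apply: cvgD; first exact: cvgM.
  by apply: cvgM; [exact: cvg_cst|exact: cvgM].
have {n0} n0 : 0 < rho2 a (kcoord x i1) (kcoord x i2).
  by rewrite lt0r n0 rho2_ge0.
near=> s; split; [|split; [apply/andP; split|apply: lt0r_neq0]]; near: s.
- exact: cvgr_gt cD _ D0.
- exact: cvgr_gt (cf i2) _ q1.
- exact: cvgr_lt (cf i2) _ q2.
- exact: cvgr_gt cn _ n0.
Unshelve. all: by end_near. Qed.

Lemma near_region i x : U x -> \forall s \near (0 : R), U (x + s *: ei i).
Proof.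
move=> Ux; pose f s := x + s *: ei i.
apply: (@cvg_region _ (nbhs (0 : R)) _ f x Ux) => j.
under eq_fun do rewrite kcoordD.
suff: (kcoord x j + s * (i == j)%:R @[s --> (0 : R)]
       --> kcoord x j + 0 * (i == j)%:R)%classic by rewrite mul0r addr0.
apply: cvgD; first exact: cvg_cst.
by apply: cvgM; [exact: cvg_id|exact: cvg_cst].
Qed.

Lemma is_derive_Delta r : is_derive r 1 (Delta M a) (2 * r - 2 * M).
Proof.
rewrite (_ : Delta M a = id ^+ 2 - (2 * M) \*: (id : R -> R) + cst (a ^+ 2)).
  by apply: is_derive_eq; rewrite /GRing.scale /=; ring.
by apply/funext => s.
Qed.

Lemma is_derive_Dq q : is_derive q 1 (@Dq R) (- (2 * q)).
Proof.
rewrite (_ : @Dq R = cst 1 - id ^+ 2); last by apply/funext => s.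
by apply: is_derive_eq; rewrite /GRing.scale /=; ring.
Qed.

Lemma is_derive_Delta1 r : is_derive r 1 (fun r => 2 * r - 2 * M) 2.
Proof.
rewrite (_ : (fun r => _) = 2 \*: (id : R -> R) - cst (2 * M)).
  by apply: is_derive_eq; rewrite /GRing.scale /=; ring.
by apply/funext => s.
Qed.

Lemma is_derive_Dq1 q : is_derive q 1 (fun q : R => - (2 * q)) (- 2).
Proof.
rewrite (_ : (fun q => _) = - (2 \*: (id : R -> R))); last by apply/funext.
by apply: is_derive_eq; rewrite /GRing.scale /=; ring.
Qed.

(** The derivative is kept as a multiple of the same power, not with exponent [p - 1]; this is the
    shape [derA] gives to [XW]. *)
Lemma is_derive_Delta_powR (p r : R) : 0 < Delta M a r ->
  is_derive r 1 (fun r => Delta M a r `^ p)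
    (p * ((2 * r - 2 * M) * ((Delta M a r)^-1 * Delta M a r `^ p))).
Proof.
move=> D0; apply: is_derive_eq.
  exact: is_derive1_comp (is_derive1_powR p D0) (is_derive_Delta r).
have -> : Delta M a r `^ (p - 1) = Delta M a r `^ p / Delta M a r.
  by rewrite powRB ?powRr1 ?(ltW D0)// (gt_eqF D0) implybT.
by field; rewrite gt_eqF.
Qed.

Definition kerr_val (Phi : pt -> C) x (A : atom) : C :=
  let r := kcoord x i1 in let q := kcoord x i2 in
  match A with
  | Xr => r%:C
  | Xq => q%:C
  | XC => (Delta M a r)%:C
  | XC1 => (2 * r - 2 * M)%:C
  | XD => (Dq q)%:C
  | XD1 => (- (2 * q))%:C
  | Xzi => lamp a x
  | Xwi => lamm a x
  | XCi => ((Delta M a r)^-1)%:C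
  | XDi => ((Dq q)^-1)%:C
  | XW => (Delta M a r `^ (k / 2))%:C
  | Ka => a%:C
  | Kb => 'i * a%:C
  | Ki => 'i%R
  | Kk => k%:C
  | Khalf => 2^-1
  | XPhi l => iterpd l Phi x
  end.

Lemma lampE x :
  lamp a x = ((kcoord x i1)%:C + 'i * a%:C * (kcoord x i2)%:C)^-1.
Proof. by rewrite /lamp; congr (_^-1); simpc. Qed.

Lemma lammE x :
  lamm a x = ((kcoord x i1)%:C - 'i * a%:C * (kcoord x i2)%:C)^-1.
Proof. by rewrite /lamm; congr (_^-1); simpc. Qed.

Lemma rho2C r q :
  (rho2 a r q)%:C = (r%:C + 'i * a%:C * q%:C) * (r%:C - 'i * a%:C * q%:C).
Proof. by rewrite /rho2; simpc; congr Complex; ring. Qed.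

(** [z] and [w] are nonzero because their product is [rho^2]. *)
Lemma region_neq0 x : U x ->
  [/\ (kcoord x i1)%:C + 'i * a%:C * (kcoord x i2)%:C != 0,
      (kcoord x i1)%:C - 'i * a%:C * (kcoord x i2)%:C != 0,
      (Delta M a (kcoord x i1))%:C != 0 & (Dq (kcoord x i2))%:C != 0].
Proof.
move=> -[/= D0 [/andP[q1 q2] n0]].
have : (rho2 a (kcoord x i1) (kcoord x i2))%:C != 0 by rewrite fmorph_eq0.
rewrite rho2C mulf_eq0 negb_or => /andP[-> ->].
rewrite !fmorph_eq0 (gt_eqF D0); split=> //.
rewrite (_ : Dq _ = (1 - kcoord x i2) * (1 + kcoord x i2)); last first.
  by rewrite /Dq; ring.
by rewrite mulf_neq0 // gt_eqF // ?subr_gt0 // -ltrBlDl sub0r.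
Qed.

Lemma kerr_val_valuation Phi x : U x -> kerr_valuation (kerr_val Phi x).
Proof.
move=> Ux; have [nz nw nC nD] := region_neq0 Ux; split; split=> //=.
- by simpc; congr Complex; ring.
- exact: lampE.
- exact: lammE.
- by rewrite fmorphV.
- by rewrite fmorphV.
Qed.

(** * Soundness of formal differentiation *)

Section Soundness.
Variables (Phi : pt -> C) (HPhi : smooth_on U Phi).
Local Notation v := (kerr_val Phi).

Lemma is_pd_iterpd i l x : U x ->
  is_pd i (iterpd l Phi) x (iterpd (i :: l) Phi x).
Proof.
move=> Ux; have [/(_ i)[dr di] _] := HPhi l Ux.
by split; rewrite /= derive1E; exact: derivableP.
Qed.

Lemma is_pd_atom i (A : atom) x : U x ->
  is_pd i (fun y => v y A) x (ev (v x) (derA i A)).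
Proof.
move=> Ux; have [nz nw _ nD] := region_neq0 Ux; have [D0 _] := Ux.
have nC : Delta M a (kcoord x i1) != 0 by rewrite gt_eqF.
have {}nD : Dq (kcoord x i2) != 0 by move: nD; rewrite fmorph_eq0.
have dr := is_pd_coord i (is_derive_id (kcoord x i1) (1 : R)).
have dq := is_pd_coord i (is_derive_id (kcoord x i2) (1 : R)).
have db := is_pdM (is_pd_cst i ('i * a%:C) x) dq.
case: A => [||||||||||||||||l].
- by apply: is_pd_eq dr _; elim/ord4_ind: i {dq db}.
- by apply: is_pd_eq dq _; elim/ord4_ind: i {dr db}.
- apply: is_pd_eq (is_pd_coord i (is_derive_Delta _)) _.
  by elim/ord4_ind: i {dr dq db}.
- apply: is_pd_eq (is_pd_coord i (is_derive_Delta1 _)) _.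
  by elim/ord4_ind: i {dr dq db} => //=; simpc.
- apply: is_pd_eq (is_pd_coord i (is_derive_Dq _)) _.
  by elim/ord4_ind: i {dr dq db}.
- apply: is_pd_eq (is_pd_coord i (is_derive_Dq1 _)) _.
  by elim/ord4_ind: i {dr dq db} => //=; simpc.
- rewrite (_ : (fun y => v y Xzi) =
    fun y => ((kcoord y i1)%:C + 'i * a%:C * (kcoord y i2)%:C)^-1); last first.
    by apply/funext => y; exact: lampE.
  apply: is_pd_eq (is_pdV nz (is_pdD dr db)) _; rewrite -lampE.
  by elim/ord4_ind: i {dr dq db} => /=; ring.
- rewrite (_ : (fun y => v y Xwi) =
    fun y => ((kcoord y i1)%:C - 'i * a%:C * (kcoord y i2)%:C)^-1); last first.
    by apply/funext => y; exact: lammE.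
  apply: is_pd_eq (is_pdV nw (is_pdD dr (is_pdN db))) _; rewrite -lammE.
  by elim/ord4_ind: i {dr dq db} => /=; ring.
- apply: is_pd_eq (is_pd_coord i (is_deriveV nC (is_derive_Delta _))) _.
  elim/ord4_ind: i {dr dq db} => //=; rewrite -!rmorphM -rmorphN.
  by congr (_%:C); rewrite /GRing.scale /=; field.
- apply: is_pd_eq (is_pd_coord i (is_deriveV nD (is_derive_Dq _))) _.
  elim/ord4_ind: i {dr dq db} => //=; rewrite -!rmorphM -rmorphN.
  by congr (_%:C); rewrite /GRing.scale /=; field.
- apply: is_pd_eq (is_pd_coord i (is_derive_Delta_powR (k / 2) D0)) _.
  elim/ord4_ind: i {dr dq db} => //=.
  by rewrite !rmorphM fmorphV rmorph_nat; ring.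
- by apply: is_pd_eq (is_pd_cst i a%:C x) _; elim/ord4_ind: i {dr dq db}.
- apply: is_pd_eq (is_pd_cst i ('i * a%:C) x) _.
  by elim/ord4_ind: i {dr dq db}.
- by apply: is_pd_eq (is_pd_cst i 'i%R x) _; elim/ord4_ind: i {dr dq db}.
- by apply: is_pd_eq (is_pd_cst i k%:C x) _; elim/ord4_ind: i {dr dq db}.
- by apply: is_pd_eq (is_pd_cst i 2^-1 x) _; elim/ord4_ind: i {dr dq db}.
- exact: is_pd_iterpd.
Qed.

Lemma is_pd_ev i e x : U x ->
  is_pd i (fun y => ev (v y) e) x (ev (v x) (der i e)).
Proof.
move=> Ux; elim: e => [||A|e IH|e IHe f IHf|e IHe f IHf] /=.
- exact: is_pd_cst.
- exact: is_pd_cst.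
- exact: is_pd_atom.
- by rewrite ev_opp; exact: is_pdN.
- by rewrite ev_add; exact: is_pdD.
- by rewrite ev_add !ev_mul; exact: is_pdM.
Qed.

(** Agreement on [U] suffices, since [U] contains a short piece of each coordinate line through [x].
    Hence identities valid only on [U] can be differentiated in turn, from the metric to [Chr] to
    [Ric]. *)
Lemma pd_ev i (f : pt -> C) e x : U x ->
  (forall y, U y -> f y = ev (v y) e) -> pd i f x = ev (v x) (der i e).
Proof.
move=> Ux fe; apply: is_pd_val; apply: near_eq_is_pd (is_pd_ev i e Ux).
near=> s; rewrite fe //; near: s; exact: near_region.
Unshelve. all: by end_near. Qed.

End Soundness.
End Valuation.

(** * The geometric quantities of the Kerr metric as values of formal expressions *)

Section Curvature.
Context {R : realType}.
Local Notation pt := ('rV[R]_4).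
Local Notation C := (R[i]).
Variables (M a k : R) (Phi : pt -> C).
Local Notation U := (regionU M a).
Local Notation v := (kerr_val M a k Phi).
Implicit Types (x y : pt) (b c d m n : 'I_4).

Lemma formAE x m : (Defs.formA a x m)%:C = ev (v x) (AX m).
Proof.
elim/ord4_ind: m => //=; rewrite /Defs.formA /= /Dq.
by rewrite !(rmorphM, rmorphN, rmorphB, rmorph1, rmorphXn); ring.
Qed.

Lemma formBE x m : (Defs.formB a x m)%:C = ev (v x) (BX m).
Proof.
elim/ord4_ind: m => //=; rewrite /Defs.formB /=.
by rewrite !(rmorphN, rmorphD, rmorphXn); ring.
Qed.

Lemma gmetE x m n : U x -> gmet M a x m n = ev (v x) (gX m n).
Proof.
move=> Ux; have [nz nw nC nD] := region_neq0 Ux.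
(* Distributing the cast over variables keeps [Delta], [rho2] and [Dq] folded in the actual
   metric. *)
have castC (p c d A A' B B' e e' : R) :
    (- (c / p) * A * A' + p / c * e + p / d * e' + d / p * B * B')%:C =
    - (c%:C / p%:C) * A%:C * A'%:C + p%:C / c%:C * e%:C + p%:C / d%:C * e'%:C
    + d%:C / p%:C * B%:C * B'%:C.
  by rewrite !(rmorphD, rmorphN, rmorphM, fmorphV).
rewrite mxE /gKerr castC !formAE !formBE rho2C lampE {castC}.
elim/ord4_ind: m; elim/ord4_ind: n => /=; rewrite ?lampE ?lammE ?fmorphV /kd /=.
all: by field; rewrite ?nz ?nw ?nC ?nD.
Qed.

(** A right inverse of a square matrix is its inverse, so the product identity [ev_gX_giX] is
    enough. *)
Lemma ginvE x m n : U x -> ginv M a x m n = ev (v x) (giX m n).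
Proof.
move=> Ux; pose G : 'M[C]_4 := \matrix_(m, n) ev (v x) (giX m n).
suff gG : gmet M a x *m G = 1%:M.
  have [gu _] := mulmx1_unit gG.
  by rewrite /ginv -[invmx _]mulmx1 -gG mulKmx // mxE.
apply/matrixP => i j.
rewrite !mxE -(ev_gX_giX i j (kerr_val_valuation k Phi Ux)).
by apply: eq_bigr => c _; rewrite gmetE // mxE.
Qed.

Hypothesis HPhi : smooth_on U Phi.

Lemma ChrE x c m n : U x -> Chr M a x c m n = ev (v x) (chrX c m n).
Proof.
move=> Ux; rewrite /Chr /chrX ev_mul ev_sum; congr (_ * _).
apply: eq_bigr => d _; rewrite ev_mul ginvE //; congr (_ * _).
by rewrite !evE !(pd_ev HPhi _ Ux (fun y => gmetE _ _)).
Qed.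

Lemma RicE x b d : U x -> Ric M a x b d = ev (v x) (ricX b d).
Proof.
move=> Ux; rewrite /Ric /ricX ev_sum; apply: eq_bigr => c _.
rewrite ev_add ev_sum ev_add ev_opp; congr (_ - _ + _).
- by apply: (pd_ev HPhi) => // y Uy; exact: ChrE.
- by apply: (pd_ev HPhi) => // y Uy; exact: ChrE.
- apply: eq_bigr => e _; rewrite ev_add ev_opp !ChrE //.
  by congr (_ - _); exact: esym (ev_mul _ _ _).
Qed.

(** In [ev_scal], [C' + b D' = 2 w - 2 M] and [C + b^2 D = z w - 2 M r]. The constants 12 cancel,
    and [2 r - z = w] leaves [12 M / z]. *)
Lemma scalE x : U x -> scal M a x = 12 * M%:C * lamp a x.
Proof.
move=> Ux; have -> : scal M a x = ev (v x) scalX.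
  rewrite /scalX ev_sum; apply: eq_bigr => b _; rewrite ev_sum.
  apply: eq_bigr => d _; rewrite ginvE // RicE //.
  exact: esym (ev_mul _ _ _).
have [_ _ [nz nw _ _]] := kerr_val_valuation k Phi Ux.
rewrite ev_scal; last exact: kerr_val_valuation.
rewrite /kerr_val lampE lammE /Delta /Dq.
rewrite !(rmorphD, rmorphN, rmorphM, rmorph1, rmorphXn, rmorph_nat).
have i2 : 'i ^+ 2 = -1 :> C by simpc; congr Complex; ring.
by field: i2; rewrite nz nw.
Qed.

Lemma aformE x m : U x -> aform M a x m = ev (v x) (aX m).
Proof.
move=> Ux; have [nz nw nC nD] := region_neq0 Ux.
have castC (c p : R) : (c / p)%:C = c%:C / p%:C by rewrite rmorphM fmorphV.
have cast2C (c p : R) : (c / (2 * p))%:C = 2^-1 * c%:C * (p^-1)%:C.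
  by rewrite invfM !rmorphM fmorphV rmorph_nat mulrCA mulrA.
rewrite /aform !cast2C !castC rho2C formAE formBE /aX !evE /=.
rewrite lampE lammE {castC cast2C} !fmorphV.
move: (ev _ (AX m)) (ev _ (BX m)) ((2 * _ - _)%:C) ((- _)%:C) => A B C1 D1.
by field; rewrite nz nw nC nD.
Qed.

Local Notation P := (fun x => (Delta M a (kcoord x i1) `^ (k / 2))%:C
                              / lamp a x * Phi x).

Lemma PE x : P x = ev (v x) PX.
Proof. by rewrite /= lampE invrK. Qed.

Lemma vfieldE x m : U x -> vfield M a k P x m = ev (v x) (vX m).
Proof.
move=> Ux; rewrite /vfield PE aformE // (pd_ev HPhi m Ux (fun y _ => PE y)).
by rewrite /vX ev_add; congr (_ + _); rewrite !ev_mul.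
Qed.

Lemma OkE x : U x -> Ok M a k P x =
  - ev (v x) boxX
  + ((1 + 2 * k ^+ 2) / 6)%:C * (12 * M%:C * lamp a x) * ev (v x) PX.
Proof.
move=> Ux; rewrite /Ok scalE // PE; congr (- _ + _).
rewrite /boxX ev_sum; apply: eq_bigr => m _; rewrite ev_sum.
apply: eq_bigr => n _; rewrite ginvE // ev_mul; congr (_ * _).
rewrite ev_add ev_add ev_opp ev_sum; congr (_ - _ + _).
- by apply: (pd_ev HPhi) => // y Uy; exact: vfieldE.
- apply: eq_bigr => c _; rewrite ChrE // vfieldE //.
  exact: esym (ev_mul _ _ _).
- by rewrite aformE // vfieldE // !ev_mul.
Qed.

End Curvature.

(** * Symmetry of mixed partial derivatives *)

Section MixedPartials.
Context {R : realType}.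
Local Notation pt := ('rV[R]_4).
Implicit Types (i j : 'I_4) (x y : pt) (h s u : R).

(** The mean value theorem is applied first to [f s h - f s 0] in [s], giving [c], then to [fs c] in
    [u], giving [d]. *)
Lemma second_difference_mvt (f fs fsu : R -> R -> R) h : 0 < h ->
  (forall s u, is_derive s 1 (f ^~ u) (fs s u)) ->
  (forall s u, is_derive u 1 (fs s) (fsu s u)) ->
  exists c d, [/\ 0 < c < h, 0 < d < h &
    f h h - f h 0 - (f 0 h - f 0 0) = fsu c d * (h * h)].
Proof.
move=> h0 dfs dfsu.
have cont (g g' : R -> R) : (forall s, is_derive s 1 g (g' s)) ->
    {within `[0, h], continuous g}%classic.
  by move=> dg; apply: derivable_within_continuous => s _; exact: ex_derive.
have dg s : is_derive s 1 (f ^~ h - f ^~ 0) (fs s h - fs s 0).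
  exact: is_deriveB.
have [c cI gc] := MVT h0 (fun s _ => dg s) (cont _ _ dg).
have [d dI fd] := MVT h0 (fun u _ => dfsu c u) (cont _ _ (dfsu c)).
exists c, d; move: cI dI; rewrite !in_itv /= => cI dI; split=> //.
by move: gc; rewrite -[LHS]/(f h h - f h 0 - (f 0 h - f 0 0)) fd => ->; ring.
Qed.

Lemma is_derive_subr (g : R -> R) (l s : R) :
  is_derive (0 : R) 1 g l -> is_derive s 1 (fun t => g (t - s)) l.
Proof.
move=> dg; rewrite -[l]mulr1 -[fun t => _]/(g \o (id - cst s)).
have ds : is_derive s 1 (id - cst s : R -> R) 1.
  by apply: is_derive_eq; rewrite subr0.
apply: (@is_derive1_comp _ g (id - cst s) s l 1 _ ds).
by rewrite -[(id - cst s) s]/(s - s) subrr.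
Qed.

(** One second difference over a small square is expressed through [Fji] and through [Fij], at two
    points of the square; continuity at [x] then forces equal values there. *)
Lemma mixed_partials_sym (F Fi Fj Fij Fji : pt -> R) x i j :
  (forall s u, let y := x + s *: ei i + u *: ei j in
    [/\ is_derive (0 : R) 1 (fun t => F (y + t *: ei i)) (Fi y),
        is_derive (0 : R) 1 (fun t => F (y + t *: ei j)) (Fj y),
        is_derive (0 : R) 1 (fun t => Fj (y + t *: ei i)) (Fij y) &
        is_derive (0 : R) 1 (fun t => Fi (y + t *: ei j)) (Fji y)]) ->
  {for x, continuous Fij} -> {for x, continuous Fji} -> Fij x = Fji x.
Proof.
move=> dF cij cji.
pose p s u := x + s *: ei i + u *: ei j.
(* Derivatives at 0 along a line issued from [p s u] become derivatives at [s], and below at [u], of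
   functions of two real variables. *)
have shiftl (G : pt -> R) s u (l : R) :
    is_derive (0 : R) 1 (fun t => G (p s u + t *: ei i)) l ->
    is_derive s 1 (fun s => G (p s u)) l.
  move=> dG.
  rewrite (_ : (fun s => _) = fun t => G (p s u + (t - s) *: ei i)).
    exact: (@is_derive_subr (fun t => G (p s u + t *: ei i))).
  apply/funext => t; congr G.
  rewrite /p [RHS]addrAC; congr (_ + _).
  by rewrite -[RHS]addrA -scalerDl [s + _]addrC subrK.
have shiftr (G : pt -> R) s u (l : R) :
    is_derive (0 : R) 1 (fun t => G (p s u + t *: ei j)) l ->
    is_derive u 1 (fun u => G (p s u)) l.
  move=> dG.
  rewrite (_ : (fun u => _) = fun t => G (p s u + (t - u) *: ei j)).
    exact: (@is_derive_subr (fun t => G (p s u + t *: ei j))).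
  apply/funext => t; congr G.
  by rewrite /p -[RHS]addrA -scalerDl [u + _]addrC subrK.
have bnd (c : R) (b : bool) : 0 < c -> `|c * b%:R| <= c.
  move=> c0; case: b; first by rewrite mulr1 gtr0_norm.
  by rewrite mulr0 normr0 ltW.
have small (G : pt -> R) (e : R) : {for x, continuous G} -> 0 < e ->
    exists2 h, 0 < h & forall c d, 0 < c < h -> 0 < d < h ->
      `|G x - G (p c d)| < e.
  move=> cG e0; have /cvgr_dist_lt/(_ _ e0)/nbhs_ballP[r /= r0 Hr] := cG.
  (* A coordinate moves by at most [c + d], both terms contributing when [i = j]; each is therefore
     kept below half the radius. *)
  exists (r / 2); first by rewrite divr_gt0.
  move=> c d /andP[c0 ch] /andP[d0 dh]; apply: Hr; split=> // a b.
  rewrite /ball /= /p !mxE -addrA opprD addrA subrr add0r normrN.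
  rewrite (le_lt_trans (ler_normD _ _)) // (splitr r) ltrD //.
    exact: le_lt_trans (bnd _ _ c0) ch.
  exact: le_lt_trans (bnd _ _ d0) dh.
apply/eqP; rewrite -subr_eq0 -normr_le0; apply/ler_addgt0Pr => e e0.
have e20 : 0 < e / 2 by rewrite divr_gt0.
have [h1 h10 H1] := small _ _ cij e20.
have [h2 h20 H2] := small _ _ cji e20.
pose h := Num.min h1 h2; have h0 : 0 < h by rewrite lt_min h10 h20.
have d1 s u : is_derive s 1 (fun s => F (p s u)) (Fi (p s u)).
  by have [D _ _ _] := dF s u; exact: (shiftl F _ _ _ D).
have d2 s u : is_derive u 1 (fun u => Fi (p s u)) (Fji (p s u)).
  by have [_ _ _ D] := dF s u; exact: (shiftr Fi _ _ _ D).
have d3 u s : is_derive u 1 (fun u => F (p s u)) (Fj (p s u)).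
  by have [_ D _ _] := dF s u; exact: (shiftr F _ _ _ D).
have d4 u s : is_derive s 1 (fun s => Fj (p s u)) (Fij (p s u)).
  by have [_ _ D _] := dF s u; exact: (shiftl Fj _ _ _ D).
have [c [d [cI dI E1]]] := second_difference_mvt (f := fun s u => F (p s u))
  (fs := fun s u => Fi (p s u)) (fsu := fun s u => Fji (p s u)) h0 d1 d2.
(* The variables exchange their roles here; the second difference itself is unchanged up to the
   order of its terms. *)
have [d' [c' [dI' cI' E2]]] := second_difference_mvt
  (f := fun u s => F (p s u)) (fs := fun u s => Fj (p s u))
  (fsu := fun u s => Fij (p s u)) h0 d3 d4.
have E : Fji (p c d) = Fij (p c' d').
  apply: (mulIf (lt0r_neq0 (mulr_gt0 h0 h0))); rewrite -E1 -E2.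
  by move: (F _) (F _) (F _) (F _) => A B A' B'; ring.
have lth t : 0 < t < h -> (0 < t < h1) && (0 < t < h2).
  by move=> /andP[-> ]; rewrite lt_min => /andP[-> ->].
have /andP[_ cI2] := lth _ cI; have /andP[_ dI2] := lth _ dI.
have /andP[cI1 _] := lth _ cI'; have /andP[dI1 _] := lth _ dI'.
(* By [E], the intermediate value [Fij (p c' d')] is also [Fji (p c d)], so it is within [e / 2] of
   both limits. *)
rewrite add0r (splitr e) -(subrKA (Fij (p c' d'))).
apply: le_trans (ler_normD _ _) _; apply: lerD; apply: ltW; first exact: H1.
by rewrite -E distrC; exact: H2.
Qed.

(** Symmetry is proved for the real and imaginary parts separately; [D] is asked to contain a whole
    plane because the mean value argument uses derivatives along all of it. *)
Lemma pd_sym (D : set pt) (f : pt -> R[i]) x i j : smooth_on D f ->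
  (forall s u, D (x + s *: ei i + u *: ei j)) ->
  pd i (pd j f) x = pd j (pd i f) x.
Proof.
move=> sf Dx.
have Dx0 : D x by have := Dx 0 0; rewrite !scale0r !addr0.
have [_ [cr ci]] := sf [:: i; j] _ Dx0.
have [_ [cr' ci']] := sf [:: j; i] _ Dx0.
have dRe n l y : D y -> is_derive (0 : R) 1
    (fun t => complex.Re (iterpd l f (y + t *: ei n)))
    (complex.Re (iterpd (n :: l) f y)).
  move=> Dy; have [/(_ n)[h _] _] := sf l _ Dy.
  by rewrite /= derive1E; exact: derivableP.
have dIm n l y : D y -> is_derive (0 : R) 1
    (fun t => complex.Im (iterpd l f (y + t *: ei n)))
    (complex.Im (iterpd (n :: l) f y)).
  move=> Dy; have [/(_ n)[_ h] _] := sf l _ Dy.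
  by rewrite /= derive1E; exact: derivableP.
apply/eqP; rewrite eq_complex; apply/andP; split; apply/eqP.
- apply: (@mixed_partials_sym (fun y => complex.Re (iterpd [::] f y))
    (fun y => complex.Re (iterpd [:: i] f y))
    (fun y => complex.Re (iterpd [:: j] f y)) _ _ x i j _ cr cr') => s u y.
  have Dy : D y := Dx s u.
  by split; [exact: (dRe i [::])|exact: (dRe j [::])|exact: (dRe i [:: j])
            |exact: (dRe j [:: i])].
- apply: (@mixed_partials_sym (fun y => complex.Im (iterpd [::] f y))
    (fun y => complex.Im (iterpd [:: i] f y))
    (fun y => complex.Im (iterpd [:: j] f y)) _ _ x i j _ ci ci') => s u y.
  have Dy : D y := Dx s u.
  by split; [exact: (dIm i [::])|exact: (dIm j [::])|exact: (dIm i [:: j])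
            |exact: (dIm j [:: i])].
Qed.

End MixedPartials.

(** * The substitution q = cos theta and the Teukolsky operator *)

Section Teukolsky.
Context {R : realType}.
Local Notation pt := ('rV[R]_4).
Local Notation C := (R[i]).
Implicit Types (i j : 'I_4) (x y z : pt) (s : R) (f : pt -> C).

Definition cos_pt y : pt :=
  mkpt (kcoord y i0) (kcoord y i1) (cos (kcoord y i2)) (kcoord y i3).

Lemma kcoord_inj x y : (forall j, kcoord x j = kcoord y j) -> x = y.
Proof. by move=> xy; apply/matrixP => m j; rewrite ord1; exact: xy. Qed.

Lemma kcoord_mkpt (x0 x1 x2 x3 : R) j :
  kcoord (mkpt x0 x1 x2 x3) j = nth 0 [:: x0; x1; x2; x3] j.
Proof. by rewrite /kcoord mxE. Qed.

Lemma kcoord_cos_pt y j :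
  kcoord (cos_pt y) j = if j == i2 then cos (kcoord y i2) else kcoord y j.
Proof. by rewrite kcoord_mkpt; elim/ord4_ind: j. Qed.

Lemma cos_pt_line y s i : i != i2 ->
  cos_pt (y + s *: ei i) = cos_pt y + s *: ei i.
Proof.
move=> /negbTE ni; apply: kcoord_inj => j.
rewrite kcoordD !kcoord_cos_pt !kcoordD ni mulr0 addr0.
by case: eqP => // ->; rewrite ni mulr0 addr0.
Qed.

(** A theta-line is carried to a q-line with a nonlinear parameter that vanishes at [s = 0]; the
    chain rule can therefore be applied at 0. *)
Lemma cos_pt_line2 y s : cos_pt (y + s *: ei i2) =
  cos_pt y + (cos (kcoord y i2 + s) - cos (kcoord y i2)) *: ei i2.
Proof.
apply: kcoord_inj => j; rewrite kcoordD !kcoord_cos_pt !kcoordD eqxx mulr1.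
rewrite [i2 == j]eq_sym; case: eqP => _; last by rewrite !mulr0.
by rewrite mulr1 [RHS]addrC subrK.
Qed.

Lemma pd_cos_pt i f y : i != i2 ->
  pd i (fun z => f (cos_pt z)) y = pd i f (cos_pt y).
Proof.
move=> ni; rewrite /pd; congr (Complex (derive1 _ _) (derive1 _ _)).
- by apply/funext => s; rewrite cos_pt_line.
- by apply/funext => s; rewrite cos_pt_line.
Qed.

Lemma is_pd_cos_pt f y (l : C) : is_pd i2 f (cos_pt y) l ->
  is_pd i2 (fun z => f (cos_pt z)) y (- (sin (kcoord y i2))%:C * l).
Proof.
case: l => b c [/= dr di].
pose g s := cos (kcoord y i2 + s) - cos (kcoord y i2).
have g0 : g 0 = 0 by rewrite /g addr0 subrr.
have dg : is_derive (0 : R) 1 g (- sin (kcoord y i2)).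
  have dc : is_derive (0 : R) 1 (cst (kcoord y i2) + id : R -> R) 1.
    by apply: is_derive_eq; rewrite add0r.
  have dcos : is_derive ((cst (kcoord y i2) + id : R -> R) 0) 1 (@cos R)
      (- sin (kcoord y i2)).
    rewrite -[(_ + id) 0]/(kcoord y i2 + 0) addr0; exact: is_derive_cos.
  rewrite -[X in is_derive _ _ _ X]mulr1 -[X in is_derive _ _ _ X]subr0.
  exact: is_deriveB (is_derive1_comp dcos dc) (is_derive_cst _ _ _).
split => /=.
- pose F s := complex.Re (f (cos_pt y + s *: ei i2)).
  have := @is_derive1_comp _ F g 0 b; rewrite g0 => /(_ _ dr dg) h.
  rewrite (_ : (fun s => _) = F \o g).
    by apply: is_derive_eq; ring.
  by apply/funext => s /=; rewrite cos_pt_line2.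
- pose F s := complex.Im (f (cos_pt y + s *: ei i2)).
  have := @is_derive1_comp _ F g 0 c; rewrite g0 => /(_ _ di dg) h.
  rewrite (_ : (fun s => _) = F \o g).
    by apply: is_derive_eq; ring.
  by apply/funext => s /=; rewrite cos_pt_line2.
Qed.

Variables (M a k : R) (Phi : pt -> C) (HPhi : smooth_on (regionU M a) Phi).
Local Notation U := (regionU M a).

Lemma near_region_cos_pt y : U (cos_pt y) ->
  \forall s \near (0 : R), U (cos_pt (y + s *: ei i2)).
Proof.
move=> Uy.
pose f s := cos_pt (y + s *: ei i2).
apply: (@cvg_region _ M a _ (nbhs (0 : R)) _ f _ Uy) => j; rewrite /f.
rewrite kcoord_cos_pt.
under eq_fun do rewrite kcoord_cos_pt !kcoordD eqxx mulr1.
rewrite eq_sym; case: eqP => _; last first.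
  by under eq_fun do rewrite mulr0 addr0; exact: cvg_cst.
have c0 : (kcoord y i2 + s @[s --> (0 : R)] --> kcoord y i2 + 0)%classic.
  by apply: cvgD; [exact: cvg_cst|exact: cvg_id].
rewrite addr0 in c0.
exact: (continuous_cvg _ (@continuous_cos R _) c0).
Qed.

(** After the product rule, [Delta^(k + 1) = Delta^k Delta] lets the outer factor [Delta^(- k)]
    cancel. *)
Lemma pd_r_term y : U (cos_pt y) ->
  (Delta M a (kcoord y i1) `^ (- k))%:C *
  pd i1 (fun z => (Delta M a (kcoord z i1) `^ (k + 1))%:C
                  * pd i1 (fun z => Phi (cos_pt z)) z) y =
  (Delta M a (kcoord y i1))%:C * iterpd [:: i1; i1] Phi (cos_pt y)
  + (k%:C + 1) * (2 * kcoord y i1 - 2 * M)%:C * iterpd [:: i1] Phi (cos_pt y).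
Proof.
move=> Uy; pose G x := (Delta M a (kcoord x i1) `^ (k + 1))%:C * pd i1 Phi x.
rewrite (_ : (fun z => _) = fun z => G (cos_pt z)); last first.
  by apply/funext => z; rewrite /G kcoord_cos_pt /= pd_cos_pt.
have [D0 _] := Uy; rewrite pd_cos_pt //.
have dD := is_pd_coord i1 (is_derive_Delta_powR (k + 1) D0).
rewrite (is_pd_val (is_pdM dD (is_pd_iterpd HPhi i1 [:: i1] Uy))).
move: D0; rewrite kcoord_cos_pt /=; move: (kcoord y i1) => r D0.
have -> : Delta M a r `^ (k + 1) = Delta M a r `^ k * Delta M a r.
  by rewrite powRD ?powRr1 ?(ltW D0) // (gt_eqF D0) implybT.
have W0 := powR_gt0 k D0; rewrite powRN; move: W0 D0.
move: (Delta M a r `^ k) (Delta M a r) (2 * r - 2 * M) => W D D1 W0 D0.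
rewrite !(rmorphM, fmorphV, rmorphD) rmorph1 /=.
by field; rewrite !fmorph_eq0 !gt_eqF.
Qed.

(** As [d_theta = - sin theta d_q], the inner term is [- D d_q Phi]; a second application of the
    rule gives [sin theta d_q (D d_q Phi)], and the sine cancels. The inner equality is needed only
    near [y]. *)
Lemma pd_theta_term y : U (cos_pt y) -> sin (kcoord y i2) != 0 ->
  (1 / sin (kcoord y i2))%:C *
  pd i2 (fun z => (sin (kcoord z i2))%:C
                  * pd i2 (fun z => Phi (cos_pt z)) z) y =
  (Dq (cos (kcoord y i2)))%:C * iterpd [:: i2; i2] Phi (cos_pt y)
  + (- (2 * cos (kcoord y i2)))%:C * iterpd [:: i2] Phi (cos_pt y).
Proof.
move=> Uy s0.
have dD := is_pd_coord i2 (is_derive_Dq (kcoord (cos_pt y) i2)).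
have dG := is_pd_cos_pt (is_pdN (is_pdM dD (is_pd_iterpd HPhi i2 [:: i2] Uy))).
rewrite (@is_pd_val _ _ _ _ _ (near_eq_is_pd _ dG)).
  rewrite kcoord_cos_pt /=.
  have {}s0 : (sin (kcoord y i2))%:C != 0 by rewrite fmorph_eq0.
  rewrite div1r fmorphV /=; move: s0.
  move: (sin _)%:C (Dq _)%:C ((- _)%:C) => S D D1 s0.
  by field.
near=> s.
have Uz : U (cos_pt (y + s *: ei i2)) by near: s; exact: near_region_cos_pt.
rewrite (is_pd_val (is_pd_cos_pt (is_pd_iterpd HPhi i2 [::] Uz))).
rewrite kcoord_cos_pt /= mulrA mulrN -rmorphM -expr2 mulNr.
congr (- (_%:C * _)).
by rewrite /Dq; apply/eqP; rewrite subr_eq addrC cos2Dsin2.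
Unshelve. all: by end_near. Qed.

Lemma TeukE y : U (cos_pt y) -> sin (kcoord y i2) != 0 ->
  Teuk M a k (fun z => Phi (cos_pt z)) y =
  teukolsky_form M%:C (kerr_val M a k Phi (cos_pt y)).
Proof.
move=> Uy s0.
have pdE i : i != i2 ->
    pd i (fun z => Phi (cos_pt z)) = fun z => pd i Phi (cos_pt z).
  by move=> ni; apply/funext => z; exact: pd_cos_pt.
rewrite /Teuk /teukolsky_form.
rewrite (pd_r_term Uy) (pd_theta_term Uy s0) !pdE // !pd_cos_pt //.
rewrite /kerr_val !kcoord_cos_pt /=.
have -> : Dq (cos (kcoord y i2)) = sin (kcoord y i2) ^+ 2.
  by rewrite /Dq -(cos2Dsin2 (kcoord y i2)) addrAC subrr add0r.
move: (Delta M a _) => D; move: (kcoord y i1) (sin _) (cos _) => r S Q.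
congr (_ * _ + _ * _ + _ * _ - _ - _ - _ * _ * _ - _ * _ * _ + _ * _).
all: rewrite ?expr_div_n !(rmorphD, rmorphN, rmorphM, fmorphV, rmorphXn) /=.
all: by rewrite ?rmorph_nat ?rmorph1.
Qed.

End Teukolsky.

(** * The operator identity, assembled at a single point *)

Unset Implicit Arguments.

(* For every smooth Phi on U (coordinates (t,r,q,phi)) and every point
   (t,r,theta,phi) with Delta(r) > 0, 0 < theta < pi, rho^2 != 0:
   O^T_k [Psi] = (lambda_+/lambda_-) (lambda_+/Delta^{k/2}) O_k(Delta^{k/2}/lambda_+ Phi)
   where Psi(t,r,theta,phi) = Phi(t,r,cos theta,phi). *)
Theorem theoremA (R : realType) (M a k : R)
  (hk : exists n : int, k = n%:~R / 2)
  (Phi : 'rV[R]_4 -> R[i]) (HPhi : smooth_on (regionU M a) Phi)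
  (t r th ph : R)
  (hD : 0 < Delta M a r) (hth : 0 < th < pi)
  (hring : rho2 a r (cos th) != 0) :
  Teuk M a k
    (fun y => Phi (mkpt (kcoord y i0) (kcoord y i1) (cos (kcoord y i2)) (kcoord y i3)))
    (mkpt t r th ph)
  = (lamp a (mkpt t r (cos th) ph) / lamm a (mkpt t r (cos th) ph))
    * (lamp a (mkpt t r (cos th) ph) / ((Delta M a r) `^ (k / 2))%:C)
    * Ok M a k
        (fun x => ((Delta M a (kcoord x i1)) `^ (k / 2))%:C / lamp a x * Phi x)
        (mkpt t r (cos th) ph).

Proof.
set x := mkpt t r (cos th) ph; set y := mkpt t r th ph.
have x1 : kcoord x i1 = r by rewrite kcoord_mkpt.
have x2 : kcoord x i2 = cos th by rewrite kcoord_mkpt.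
have y2 : kcoord y i2 = th by rewrite kcoord_mkpt.
have cy : cos_pt y = x by rewrite /cos_pt !kcoord_mkpt.
have s0 : 0 < sin th by exact: sin_gt0_pi.
have Dc : 0 < Dq (cos th).
  by rewrite /Dq -(cos2Dsin2 th) addrAC subrr add0r exprn_gt0.
have Ux : regionU M a x.
  rewrite /regionU /= x1 x2; do 2! [split=> //].
  by rewrite -ltr_norml -(@expr_lt1 _ 2) // real_normK ?num_real // -subr_gt0.
(* The region only constrains r and q, so it contains the whole (t, phi)-plane
   through x. *)
have Dxs s u : regionU M a (x + s *: ei i0 + u *: ei i3).
  by move: Ux; rewrite /regionU /= !kcoordD !mulr0 !addr0.
pose v := kerr_val M a k Phi x.
have vW : v XW != 0.
  by rewrite /v /kerr_val x1 fmorph_eq0; exact: lt0r_neq0 (powR_gt0 _ hD).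
have vC : v XC = v Xr ^+ 2 - 2 * M%:C * v Xr + v Ka ^+ 2.
  rewrite /v /kerr_val /Delta rmorphD rmorphB !rmorphXn !rmorphM.
  by rewrite rmorph_nat.
have vD : v XD = 1 - v Xq ^+ 2 by rewrite /v /kerr_val /Dq rmorphB rmorphXn.
have vC1 : v XC1 = 2 * v Xr - 2 * M%:C.
  by rewrite /v /kerr_val rmorphB !rmorphM !rmorph_nat.
have vD1 : v XD1 = - (2 * v Xq).
  by rewrite /v /kerr_val rmorphN rmorphM rmorph_nat.
have k6 : ((1 + 2 * k ^+ 2) / 6)%:C = (1 + 2 * k%:C ^+ 2) / 6 :> R[i].
  by rewrite rmorphM fmorphV rmorphD rmorphM rmorphXn !rmorph_nat.
have Uy : regionU M a (cos_pt y) by rewrite cy.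
have sy : sin (kcoord y i2) != 0 by rewrite y2 lt0r_neq0.
(* The function in the statement is [Phi] after [cos_pt], up to unfolding. Turning [r] back into
   [kcoord x i1] makes the power of [Delta] in the prefactor the value of [XW]. *)
rewrite [LHS](TeukE k HPhi Uy sy) cy (OkE k HPhi Ux) k6 -[in RHS]x1.
exact: esym (ev_box (kerr_val_valuation k Phi Ux) vW vC vD vC1 vD1
               (pd_sym HPhi Dxs) (erefl _)).
Qed.
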